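(* Let $P_n$, $n\ge 1$, be a sequence of probability measures on $\mathcal{H}$ and let $\tau=\tau_n\ge 0$, $\rho=\rho_n\ge 0$ be random smoothing parameters. Let $\sigma_n^2(\alpha)=\sigma_{\mathrm R}^2(P_n[\alpha])$ for $\alpha\in\mathcal H$, and define $$\widehat\phi_1=\arg\max_{\|\alpha\|_\tau=1}\{\sigma_n^2(\alpha)-\rho\Psi(\alpha)\},\qquad \widehat\phi_m=\arg\max_{\alpha\in\widehat{\mathcal B}_{m,\tau}}\{\sigma_n^2(\alpha)-\rho\Psi(\alpha)\},\quad m\ge 2,$$ where $\widehat{\mathcal B}_{m,\tau}=\{\alpha\in\mathcal H:\ \|\alpha\|_\tau=1,\ \langle\alpha,\widehat\phi_j\rangle_\tau=0\ \text{ for all } 1\le j\le m-1\}$, and put $\widehat\lambda_m=\sigma_n^2(\widehat\phi_m)$. Let $P$ be a probability measure on $\mathcal H$ such that, for some $q\ge 2$, the directions $\phi_{\mathrm R,j}=\phi_{\mathrm R,j}(P)$, $1\le j\le q$, are unique up to a sign change. Assume that: (i) the function $\sigma:\mathcal H\to\mathbb R$, $\sigma(\alpha)=\sigma_{\mathrm R}(P[\alpha])$, is continuous with respect to the weak topology of $\mathcal H$; (ii) $\sup_{\|\alpha\|=1}|\sigma_n^2(\alpha)-\sigma_{\mathrm R}^2(P[\alpha])|\to 0$ almost surely; (iii) $\tau_n\to 0$ and $\rho_n\to 0$ almost surely; (iv) moreover, if $\tau_n>0$ or $\rho_n>0$, for all $n\ge n_0$, then $\phi_{\mathrm R,j}\in\mathcal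 H_{\mathrm S}$, that is, $\Psi(\phi_{\mathrm R,j})<\infty$, for all $1\le j\le q$. Then, as $n\to\infty$: (a) $\widehat\lambda_1\to\lambda_{\mathrm R,1}$ and $\sigma^2(\widehat\phi_1)\to\sigma^2(\phi_{\mathrm R,1})$ almost surely. Moreover, $\rho\Psi(\widehat\phi_1)\to 0$ and $\tau\lceil\widehat\phi_1,\widehat\phi_1\rceil\to 0$ almost surely, and so $\|\widehat\phi_1\|\to 1$ almost surely. (b) $\langle\widehat\phi_1,\phi_{\mathrm R,1}\rangle^2\to 1$ almost surely. (c) For any $2\le m\le q$, if $\widehat\phi_\ell\to\phi_{\mathrm R,\ell}$, $\tau\Psi(\widehat\phi_\ell)\to 0$ and $\rho\Psi(\widehat\phi_\ell)\to 0$ almost surely for $1\le\ell\le m-1$, then $\widehat\lambda_m\to\sigma^2(\phi_{\mathrm R,m})$ and $\sigma^2(\widehat\phi_m)\to\sigma^2(\phi_{\mathrm R,m})$ almost surely. Moreover, $\rho\Psi(\widehat\phi_m)\to 0$ and $\tau\Psi(\widehat\phi_m)\to 0$ almost surely, and so $\|\widehat\phi_m\|\to 1$ almost surely. (d) For $1\le m\le q$, $\langle\widehat\phi_m,\phi_{\mathrm R,m}\rangle^2\to 1$ almost surely.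
   Context: $\mathcal H$ is a separable real Hilbert space with inner product $\langle\cdot,\cdot\rangle$ and norm $\|\cdot\|$. All random quantities live on a common probability space; the measures $P_n$ may be random (e.g. empirical measures). Scale functional: let $\mathcal G$ be the set of all univariate probability distributions. A scale functional is a map $\sigma_{\mathrm R}:\mathcal G\to[0,+\infty)$ such that, for all real $a,b$ and all $G\in\mathcal G$, $\sigma_{\mathrm R}(G_{a,b})=|a|\,\sigma_{\mathrm R}(G)$, where $G_{a,b}$ is the distribution of $aY+b$ when $Y\sim G$. A scale functional $\sigma_{\mathrm R}$ is fixed. For a probability measure $Q$ on $\mathcal H$ and $\alpha\in\mathcal H$, $Q[\alpha]$ denotes the distribution of $\langle\alpha,X\rangle$ when $X\sim Q$. For $P$, write $\sigma(\alpha)=\sigma_{\mathrm R}(P[\alpha])$. Principal directions and values: $\phi_{\mathrm R,1}(P)=\arg\max_{\|\alpha\|=1}\sigma_{\mathrm R}(P[\alpha])$ and, for $m\ge 2$, $\phi_{\mathrm R,m}(P)=\arg\max_{\|\alpha\|=1,\ \alpha\in\mathcal B_m}\sigma_{\mathrm R}(P[\alpha])$, where $\mathcal B_m=\{\alpha\in\mathcal H:\langle\alpha,\phi_{\mathrm R,j}(P)\rangle=0,\ 1\le j\le m-1\}$; and $\lambda_{\mathrm R,m}=\lambda_{\mathrm R,m}(P)=\sigma_{\mathrm R}^2(P[\phi_{\mathrm R,m}])$. Penalization: $\mathcal H_{\mathrm S}\subset\mathcal H$ is the (linear) subset of ''smooth elements'', $D:\mathcal H_{\mathrm S}\to\mathcal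 H$ is a linear operator, $\lceil\alpha,\beta\rceil=\langle D\alpha,D\beta\rangle$ for $\alpha,\beta\in\mathcal H_{\mathrm S}$ (a symmetric positive semidefinite bilinear form, assumed closable), $\Psi(\alpha)=\lceil\alpha,\alpha\rceil$ for $\alpha\in\mathcal H_{\mathrm S}$ and $\Psi(\alpha)=\infty$ for $\alpha\notin\mathcal H_{\mathrm S}$. For $\tau\ge0$, $\langle\alpha,\beta\rangle_\tau=\langle\alpha,\beta\rangle+\tau\lceil\alpha,\beta\rceil$ and $\|\alpha\|_\tau^2=\|\alpha\|^2+\tau\Psi(\alpha)$. Convention: $\rho\Psi(\alpha)$ is $0$ when $\rho=0$, and $\tau\Psi(\alpha)$ (likewise $\tau\lceil\alpha,\beta\rceil$) is $0$ when $\tau=0$, even if $\alpha\notin\mathcal H_{\mathrm S}$. Throughout, $\arg\max$ denotes an element attaining the maximum (the maximizers are understood to exist). The sign of $\widehat\phi_\ell$ (or of $\phi_{\mathrm R,\ell}$) is arbitrary. Dependence of $\widehat\phi_m,\widehat\lambda_m,\tau,\rho$ on $n$ is suppressed. *)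

(* Defs.v *)
From HB Require Import structures.
From mathcomp Require Import all_boot all_order all_algebra.
From mathcomp Require Import sesquilinear.
From mathcomp Require Import all_classical all_reals all_analysis.
From mathcomp Require Import measurable_realfun.
From mathcomp Require Import ring.

Set Implicit Arguments.
Unset Strict Implicit.
Unset Printing Implicit Defensive.

Import Order.TTheory GRing.Theory Num.Theory.
Import numFieldNormedType.Exports.

Local Open Scope classical_set_scope.
Local Open Scope ring_scope.

HB.mixin Record CompleteNormedModule_isHilbert (R : realType) H
    of CompleteNormedModule R H := {
  inner : {dot H for @idfun R} ;
  inner_norm : forall x : H, inner x x = `|x| ^+ 2
}.

#[short(type="hilbertType")]
HB.structure Definition Hilbert (R : realType) :=
  {H of CompleteNormedModule_isHilbert R H & CompleteNormedModule R H}.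

Section hilbert.
Context {R : realType} {H : hilbertType R}.
Implicit Types x y z : H.


Lemma innerC x y : inner x y = inner y x.
Proof.
have := @hermitian_subproof R H false (@idfun R) (@inner R H) x y.
by rewrite expr0 mul1r.
Qed.

Lemma innerB_norm x y t :
  `|x - t *: y| ^+ 2 = `|x| ^+ 2 - t *+ 2 * inner x y + t ^+ 2 * `|y| ^+ 2.
Proof.
rewrite -!inner_norm linearBr/= !linearBl/= !linearZr_LR/= !linearZl_LR/=.
rewrite (innerC y x) /= mulr2n -[t *: (t * _)]/(t * (t * _)); ring.
Qed.

Lemma cauchy_schwarz x y : `|inner x y| <= `|x| * `|y|.
Proof.
have [->|y0] := eqVneq y 0; first by rewrite linear0r !normr0 mulr0.
have ny : 0 < `|y| ^+ 2 by rewrite exprn_gt0// normr_gt0.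
rewrite -(@ler_pXn2r _ 2) ?nnegrE// ?mulr_ge0// real_normK ?num_real// exprMn.
have := sqr_ge0 `|x - (inner x y / `|y| ^+ 2) *: y|.
rewrite innerB_norm => h; rewrite -subr_ge0.
rewrite (_ : _ - _ = (`|x| ^+ 2 - (inner x y / `|y| ^+ 2) *+ 2 * inner x y +
  (inner x y / `|y| ^+ 2) ^+ 2 * `|y| ^+ 2) * `|y| ^+ 2).
  by rewrite mulr_ge0// ltW.
by rewrite mulr2n; field; rewrite normr_eq0.
Qed.

Lemma inner_continuous x : continuous (fun y : H => inner x y : R).
Proof.
move=> y; apply/(@cvgrPdist_le _ R^o) => e e0.
near=> z.
rewrite -linearBr/=; apply: le_trans (cauchy_schwarz _ _) _.
have x1 : 0 < `|x| + 1 by rewrite ltr_wpDl.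
rewrite (@le_trans _ _ ((`|x| + 1) * `|y - z|))//.
  by rewrite ler_wpM2r// lerDl.
rewrite -ler_pdivlMl// mulrC; near: z.
by apply: cvgr_dist_le => //; rewrite divr_gt0.
Unshelve. all: by end_near. Qed.

End hilbert.

Definition separable_space (T : topologicalType) :=
  exists2 A : set T, countable A & dense A.

(* The coarsest topology making every x |-> inner y x continuous; by the Riesz
   theorem these are all the continuous linear functionals *)
Definition weak_space (R : realType) (H : hilbertType R) : topologicalType :=
  sup_topology (fun y : H =>
    Topological.class (initial_topology (fun x : H => inner y x : R))).

Definition borel_space (R : realType) (H : hilbertType R) :=
  g_sigma_algebraType (@open H).

Section marginal.
Context {R : realType} {H : hilbertType R}.

Definition projection (a : H) (x : borel_space H) : R := inner a x.

Lemma measurable_projection a : measurable_fun setT (projection a).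
Proof.
move=> _; apply: (measurability _ (RGenOpens.measurableE R)) => //.
move=> _ [_ [x [y ->]] <-]; rewrite setTI; apply: sub_sigma_algebra.
by move/continuousP: (@inner_continuous R H a); apply; exact: interval_open.
Qed.

HB.instance Definition _ a :=
  isMeasurableFun.Build _ _ _ _ (projection a) (measurable_projection a).

Definition marginal (Q : probability (borel_space H) R) (a : H)
  : probability R R := distribution Q (projection a).

End marginal.

Section scale.
Context {R : realType}.

Definition affine (a b : R) (y : R) : R := a * y + b.

Lemma measurable_affine a b : measurable_fun setT (affine a b).
Proof. by apply: measurable_funD => //; exact: mulrl_measurable. Qed.

HB.instance Definition _ a b :=
  isMeasurableFun.Build _ _ _ _ (affine a b) (measurable_affine a b).

(* scale_ext: elements of [probability R R] are functions on all subsets of R, so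
   two of them may represent the same distribution while differing on
   non-measurable sets *)
Record scale_functional (s : probability R R -> R) : Prop := {
  scale_ge0 : forall G, 0 <= s G ;
  scale_ext : forall G G' : probability R R,
    (forall A, measurable A -> G A = G' A) -> s G = s G' ;
  scale_affine : forall (a b : R) (G : probability R R),
    s (distribution G (affine a b)) = `|a| * s G
}.

End scale.

Definition is_argmax T disp (V : porderType disp) (A : set T) (f : T -> V) x :=
  A x /\ forall y, A y -> (f y <= f x)%O.

Definition dir_scale {R : realType} {H : hilbertType R}
  (s : probability R R -> R) (Q : probability (borel_space H) R) (a : H) : R :=
  s (marginal Q a).

Section principal_directions.
Context {R : realType} {H : hilbertType R}.
Variables (s : probability R R -> R) (P : probability (borel_space H) R).

Definition sphere_orth (phi : nat -> H) (m : nat) : set H :=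
  [set a | `|a| = 1 /\ forall j, (1 <= j < m)%N -> inner a (phi j) = 0].

(* Directions are numbered from 1; the orthogonality is void for m = 1 *)
Definition principal_direction (phi : nat -> H) (m : nat) (a : H) :=
  is_argmax (sphere_orth phi m) (dir_scale s P) a.

Definition principal_value (phi : nat -> H) (m : nat) : R :=
  dir_scale s P (phi m) ^+ 2.

End principal_directions.

(* The operator D : HS -> H is a function on H whose values outside HS are
   irrelevant *)
Section penalization.
Context {R : realType} {H : hilbertType R}.
Variables (HS : set H) (D : H -> H).

Definition linear_subset := HS 0 /\
  forall (c : R) x y, HS x -> HS y -> HS (c *: x + y).

Definition linear_on :=
  forall (c : R) x y, HS x -> HS y -> D (c *: x + y) = c *: D x + D y.

Definition pen_form (x y : H) : R := inner (D x) (D y).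

Definition closable := forall u : nat -> H, (forall n, HS (u n)) ->
  u @ \oo --> (0 : H) ->
  (forall e : R, 0 < e -> exists N : nat, forall n k : nat,
     (N <= n)%N -> (N <= k)%N -> pen_form (u n - u k) (u n - u k) < e) ->
  (fun n => pen_form (u n) (u n)) @ \oo --> (0 : R).

Definition Psi (x : H) : \bar R :=
  if x \in HS then (pen_form x x)%:E else +oo%E.

Definition inner_tau (t : R) (x y : H) : R := inner x y + t * pen_form x y.

(* In \bar R, 0 * +oo = 0 *)
Definition norm_tau (t : R) (x : H) : \bar R :=
  sqrte ((`|x| ^+ 2)%:E + t%:E * Psi x)%E.

Definition smooth_feasible (t : R) (phi : nat -> H) (m : nat) : set H :=
  [set a | norm_tau t a = 1%E /\
           forall j, (1 <= j < m)%N -> inner_tau t a (phi j) = 0].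

Definition smooth_direction (s : probability R R -> R)
    (Q : probability (borel_space H) R) (t r : R) (phi : nat -> H) (m : nat)
    (a : H) :=
  is_argmax (smooth_feasible t phi m)
    (fun b => (dir_scale s Q b ^+ 2)%:E - r%:E * Psi b)%E a.

End penalization.

Definition cvg_as d (Omega : measurableType d) (R : realType)
    (Pr : probability Omega R) (T : topologicalType)
    (X : nat -> Omega -> T) (l : T) :=
  {ae Pr, forall w, X n w @[n --> \oo] --> l}.

(* Main.v *)
Require Import Defs.
From HB Require Import structures.
From mathcomp Require Import all_boot all_order all_algebra.
From mathcomp Require Import all_classical all_reals all_analysis.
From mathcomp Require Import sesquilinear.
From mathcomp Require Import ring lra.

Set Implicit Arguments.
Unset Strict Implicit.
Unset Printing Implicit Defensive.

Import Order.TTheory GRing.Theory Num.Theory.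
Import numFieldNormedType.Exports.

Local Open Scope classical_set_scope.
Local Open Scope ring_scope.

(** Everything happens on one path of the probability space, so the proof is
about deterministic sequences; the exceptional null sets are those of the almost
sure hypotheses on the scales and on the smoothing parameters.

On a path, write t, r for the smoothing parameters and h_m for the m-th estimated
direction, and set A x := sqrt t D x and C x := sqrt r D x.  The inner product <x, y> + <A x, A y> is that of the graph of
A; the estimated directions are orthonormal for it, and they maximise the
empirical squared scale minus |C x|^2.  When t = r = 0 both operators vanish and
are linear on all of H, so all the cases of the convention 0 * oo = 0 become
one (smooth_direction_graph).

The principal directions are recovered one after the other (step_recovered).
Suppose that the first m - 1 are, up to sign, with vanishing penalties.
- Lower bound: the Gram-Schmidt correction of phi_m against the earlier estimated
  directions is feasible once normalised.  It converges to phi_m and its penalties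
  vanish, so the optimal value is at least sigma^2(phi_m) - o(1).
- Upper bound: the orthogonality constraints force <h_m, phi_l> -> 0 for l < m.
  The unit ball is weakly compact and sigma is weakly continuous, so a statement
  that holds exactly under exact constraints holds asymptotically under asymptotic
  constraints (weak_compact_transfer); hence sigma^2(h_m) <= sigma^2(phi_m) + o(1).
The two bounds squeeze |C h_m|^2 to 0 and both scales to sigma^2(phi_m).

If sigma(phi_m) > 0, the same compactness principle and the uniqueness of phi_m
give <h_m, phi_m>^2 -> 1, and then |h_m| -> 1 and A h_m -> 0.  If
sigma(phi_m) = 0, every unit vector orthogonal to the earlier directions is a
maximiser, so uniqueness forces H to be spanned by phi_1, .., phi_m; on this
finite-dimensional space A tends to 0, and the same conclusions follow.

So all the assertions about direction m hold for every m up to q by induction, and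
the four parts of the theorem are read off from them.

Weak compactness of the ball is proved with ultrafilters: the weak limit of an
ultrafilter on the ball is a bounded linear functional, which is represented by a
vector (riesz_representation). *)

(** * Inner products and the representation theorem *)

Section inner_product.
Context {R : realType} {H : hilbertType R}.
Implicit Types x y z : H.

Lemma innerDl x y z : inner (x + y) z = inner x z + inner y z.
Proof. exact: linearDl. Qed.

Lemma innerBl x y z : inner (x - y) z = inner x z - inner y z.
Proof. exact: linearBl. Qed.

Lemma innerZl (c : R) x z : inner (c *: x) z = c * inner x z.
Proof. exact: linearZl_LR. Qed.

Lemma innerNl x z : inner (- x) z = - inner x z.
Proof. exact: linearNl. Qed.

Lemma innerDr x y z : inner x (y + z) = inner x y + inner x z.
Proof. exact: linearDr. Qed.

Lemma innerNr x z : inner x (- z) = - inner x z.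
Proof. exact: linearNr. Qed.

Lemma innerBr x y z : inner x (y - z) = inner x y - inner x z.
Proof. exact: linearBr. Qed.

Lemma innerZr (c : R) x z : inner x (c *: z) = c * inner x z.
Proof. exact: linearZr_LR. Qed.

Lemma inner_suml (I : Type) (r : seq I) (p : pred I) (F : I -> H) z :
  inner (\sum_(i <- r | p i) F i) z = \sum_(i <- r | p i) inner (F i) z.
Proof.
by apply: (big_morph (fun x => inner x z)) => [x y|];
  rewrite ?innerDl ?linear0l.
Qed.

Lemma inner_sqr_le x y : inner x y ^+ 2 <= `|x| ^+ 2 * `|y| ^+ 2.
Proof.
rewrite -exprMn -[leLHS]real_normK ?num_real//.
by rewrite ler_sqr ?nnegrE ?mulr_ge0 ?cauchy_schwarz.
Qed.

Lemma parallelogram x y :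
  `|x - y| ^+ 2 + `|x + y| ^+ 2 = 2 * `|x| ^+ 2 + 2 * `|y| ^+ 2.
Proof.
rewrite -!inner_norm !(innerDl, innerNl, innerDr, innerNr); ring.
Qed.

End inner_product.

Section riesz.
Context {R : realType} {H : hilbertType R}.

(** The representing vector minimises J y := |y|^2 - 2 f y.  By the parallelogram
law the sublevel sets of J near its infimum form a Cauchy filter, and a
near-minimiser of J nearly represents f. *)
Lemma riesz_representation (f : H -> R) :
  (forall (c : R) x y, f (c *: x + y) = c * f x + f y) ->
  (forall x, `|f x| <= `|x|) ->
  exists a : H, forall z, inner a z = f z.
Proof.
move=> fL fb.
pose J (y : H) := `|y| ^+ 2 - 2 * f y.
have J_ge y : -1 <= J y.
  have := fb y; rewrite ler_norml => /andP[_ h].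
  have := sqr_ge0 (`|y| - 1); rewrite /J; nra.
pose E : set R := range J.
have infE : has_inf E.
  split; first by exists (J 0), 0.
  by exists (-1) => _ [y _ <-].
have m_le y : inf E <= J y by apply: inf_lbound; [case: infE|exists y].
pose V e := [set y : H | J y < inf E + e].
have V_ne e : 0 < e -> V e !=set0.
  by move=> e0; have [_ [y _ <-] h] := inf_adherent e0 infE; exists y.
pose F := filter_from [set e : R | 0 < e] V.
have FF : ProperFilter F.
  apply: filter_from_proper; last by move=> e /V_ne.
  apply: filter_from_filter; first by exists 1 => /=.
  move=> i j /= i0 j0; exists (Num.min i j); first by rewrite lt_min i0.
  by move=> y; rewrite /V /= -ltrBlDl lt_min => /andP[]; rewrite !ltrBlDl.
have J_mid x y : `|x - y| ^+ 2 <= 2 * (J x - inf E) + 2 * (J y - inf E).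
  have := m_le (2^-1 *: (x + y)).
  rewrite /J normrZ exprMn.
  have -> : f (2^-1 *: (x + y)) = 2^-1 * (f x + f y).
    have f0 : f 0 = 0.
      by have := fL 1 0 0; rewrite scaler0 addr0 mul1r; lra.
    rewrite -[_ *: _]addr0 fL f0 addr0; congr (_ * _).
    by rewrite -[x in x + y]scale1r fL mul1r.
  rewrite ger0_norm ?invr_ge0// => h.
  have := parallelogram x y; move: h; lra.
have Fcauchy : cauchy F.
  apply/cauchy_ballP => e e0.
  have d0 : 0 < e ^+ 2 / 4 by rewrite divr_gt0 // exprn_gt0.
  exists (V (e ^+ 2 / 4), V (e ^+ 2 / 4)) => /=.
    by split; exists (e ^+ 2 / 4).
  move=> [x y] [/= Vx Vy]; rewrite -ball_normE /ball_ /=.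
  rewrite -(ltr_pXn2r (ltn0Sn 1)) ?nnegrE ?(ltW e0)//.
  apply: le_lt_trans (J_mid x y) _; move: Vx Vy; rewrite /V /=; lra.
have /cauchy_cvgP Fcvg := Fcauchy.
exists (lim F) => z.
have h1 : inner z y @[y --> F] --> inner z (lim F).
  by apply: cvg_comp Fcvg _; exact: inner_continuous.
have h2 : inner z y @[y --> F] --> f z.
  (* compare y with its best modification along z: a decrease of J beyond e would
     go below the infimum *)
  have J_grad e y : V e y -> (inner z y - f z) ^+ 2 <= e * `|z| ^+ 2.
    move=> Vy.
    have [->|z0] := eqVneq z 0.
      have f0 : f 0 = 0.
        by have := fL 1 0 0; rewrite scaler0 addr0 mul1r; lra.
      by rewrite linear0l f0 subr0 normr0 expr0n /= mulr0.
    have z2 : 0 < `|z| ^+ 2 by rewrite exprn_gt0 // normr_gt0.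
    pose t := (inner z y - f z) / `|z| ^+ 2.
    have := m_le (- t *: z + y).
    rewrite /J fL [- t *: z + y]addrC scaleNr innerB_norm (innerC y z) => h.
    have -> : (inner z y - f z) ^+ 2 = (t * (inner z y - f z)) * `|z| ^+ 2.
      by rewrite /t; field; rewrite normr_eq0.
    have tz : t ^+ 2 * `|z| ^+ 2 = t * (inner z y - f z).
      by rewrite /t; field; rewrite normr_eq0.
    rewrite ler_pM2r //; move: h; rewrite tz mulr2n.
    move: Vy; rewrite /V/J/=; lra.
  apply/cvgrPdist_le => e e0.
  have z1 : 0 < `|z| + 1 by rewrite ltr_wpDl.
  exists ((e / (`|z| + 1)) ^+ 2); first by rewrite /= exprn_gt0 // divr_gt0.
  move=> y /J_grad h.
  rewrite -(ler_pXn2r (ltn0Sn 1)) ?nnegrE ?(ltW e0)//.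
  rewrite real_normK ?num_real// -sqrrN opprB (le_trans h)//.
  rewrite expr_div_n mulrAC ler_pdivrMr ?exprn_gt0// ler_pM2l ?exprn_gt0//.
  by rewrite ler_sqr ?nnegrE ?(ltW z1)// lerDl.
rewrite innerC; apply: cvg_unique h1 h2; exact: norm_hausdorff.
Qed.

End riesz.

(** * Weak compactness of the unit ball *)

Section weak_topology.
Context {R : realType} {H : hilbertType R}.

Lemma weak_cvgP (F : set_system H) {FF : Filter F} (a : H) :
  (forall y : H, inner y x @[x --> F] --> inner y a) ->
  F --> (a : weak_space H).
Proof.
move=> Fa; apply/(@cvg_sup H H _ F a) => y A [_ [[B oB <-] Ba BA]].
by apply: filterS BA _; apply: (Fa y); exact: open_nbhs_nbhs.
Qed.

Lemma cvg_weak (F : set_system H) {FF : Filter F} (a : H) :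
  F --> a -> F --> (a : weak_space H).
Proof.
move=> Fa; apply: weak_cvgP => y.
by apply: cvg_comp Fa _; exact: inner_continuous.
Qed.

Lemma weak_continuous_inner (y : H) :
  continuous (fun x : weak_space H => inner y x : R).
Proof.
move=> a; apply: cvg_trans (@initial_continuous H R (inner y) a).
apply: cvg_app; exact: (iffLR (@cvg_sup H H _ (nbhs (a : weak_space H)) a _)
  cvg_id y).
Qed.

Lemma ultra_cvg_bounded (F : set_system H) (u : H -> R) (M : R) :
  UltraFilter F -> F [set x | `|u x| <= M] ->
  exists l : R, u x @[x --> F] --> l.
Proof.
move=> FU FM.
have FI : F (u @^-1` [set` `[- M, M]]).
  by apply: filterS FM => x /=; rewrite in_itv /= ler_norml.
have : compact [set` `[- M, M]] by exact: segment_compact.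
case/(_ (u @ F) _ FI).
move=> l [_ cl]; exists l => B /= nB.
have [//|FB] := in_ultra_setVsetC (u @^-1` B) FU.
by have [x []] := cl (~` B) B FB nB.
Qed.

Lemma weak_compact_ball : compact ([set a | `|a| <= 1] : set (weak_space H)).
Proof.
rewrite compact_ultra => F FU FB.
have bnd (y x : H) : `|x| <= 1 -> `|inner y x| <= `|y|.
  by move=> x1; rewrite (le_trans (cauchy_schwarz _ _))// ler_piMr.
have lim_ex y : exists l : R, inner y x @[x --> F] --> l.
  apply: (@ultra_cvg_bounded F (inner y) `|y| FU).
  by apply: filterS FB => x; exact: bnd.
have [f Ff] := choice lim_ex.
have [a fa] : exists a : H, forall z, inner a z = f z.
  apply: riesz_representation.
    move=> c x y; apply: cvg_unique (Ff _) _; first exact: norm_hausdorff.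
    have -> : inner (c *: x + y) = (fun z => c * inner x z + inner y z).
      by apply/funext => z; rewrite innerDl innerZl.
    apply: (@cvgD _ R^o); last exact: Ff.
    by apply: cvgM; [exact: cvg_cst|exact: Ff].
  move=> x; have : `|inner x y| @[y --> F] --> `|f x| by apply: cvg_norm.
  by move/cvgr_to_le; apply; apply: filterS FB => y; exact: bnd.
have Fa : F --> (a : weak_space H).
  by apply: weak_cvgP => y; rewrite innerC fa.
exists a; split=> //=.
have : inner a a <= `|a|.
  have aa := Ff a; rewrite -fa in aa.
  apply: (cvgr_to_le aa).
  by apply: filterS FB => y /(bnd a); apply: le_trans; exact: ler_norm.
rewrite inner_norm expr2; have [->//|a0] := eqVneq a 0; first by rewrite normr0.
by rewrite -[leRHS]mul1r ler_pM2r // normr_gt0.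
Qed.

(** The form in which compactness is used: an implication between equations in
weakly continuous functions on the unit ball passes to limits along sequences.  A
point of the ball where g is far from c' has f different from c, and by compactness
f stays at a positive distance from c on the set of such points. *)
Lemma weak_compact_transfer (h : nat -> H) (f g : weak_space H -> R) (c c' : R) :
  continuous f -> continuous g ->
  (\forall n \near \oo, `|h n| <= 1) ->
  f (h n) @[n --> \oo] --> c ->
  (forall a : H, `|a| <= 1 -> f a = c -> g a = c') ->
  g (h n) @[n --> \oo] --> c'.
Proof.
move=> cf cg h1 fc fg; apply/cvgrPdist_lt => e e0.
have c_dist (u : weak_space H -> R) k :
    continuous u -> continuous (fun a => `|k - u a| : R).
  move=> cu x; have : k - u a @[a --> x] --> k - u x.
    exact: (@cvgB _ R^o _ _ _ (fun=> k) u k (u x) (cvg_cst k) (cu x)).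
  by move/(@cvg_norm _ R^o).
pose A := [set a : weak_space H | `|a : H| <= 1] `&`
  (fun a => `|c' - g a|) @^-1` [set r | e <= r].
have A_far n : `|h n| <= 1 -> ~ A (h n) -> `|c' - g (h n)| < e.
  by move=> hn nA; rewrite ltNge; apply/negP => eh; apply: nA.
have [A0|/set0P A0] := eqVneq A set0.
  by near=> n; apply: A_far; [near: n|rewrite A0].
have cA : compact A.
  apply: compact_closedI; first exact: weak_compact_ball.
  apply: closed_comp; last exact: closed_ge.
  by move=> x _; exact: c_dist.
have [|a] := @compact_EVT_min _ R (fun a => `|c - f a|) A A0 cA.
  by apply: continuous_subspaceT; exact: c_dist.
rewrite inE => -[/= a1 ae] amin.
have d0 : 0 < `|c - f a|.
  rewrite normr_gt0 subr_eq0; apply/eqP => /esym /(fg _ a1) ga.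
  by move: ae; rewrite ga subrr normr0 leNgt e0.
near=> n; apply: A_far; first by near: n.
move=> /mem_set /amin; apply/negP; rewrite -ltNge.
near: n; move/cvgrPdist_lt : fc; exact.
Unshelve. all: by end_near. Qed.

End weak_topology.

(** * Limits of real functions *)

Section real_sequences.
Context {R : realType} {T : Type} (F : set_system T) {FF : Filter F}.

Lemma squeeze0 (u v : T -> R) :
  (\forall x \near F, 0 <= u x <= v x) -> v x @[x --> F] --> (0 : R) ->
  u x @[x --> F] --> (0 : R).
Proof.
by move=> uv; apply: (squeeze_cvgr (f := fun=> 0) uv); exact: cvg_cst.
Qed.

Lemma cvg_sqr0 (u : T -> R) :
  u x ^+ 2 @[x --> F] --> (0 : R) -> u x @[x --> F] --> (0 : R).
Proof.
move=> u0; apply/(@cvgr0Pnorm_lt _ R^o) => e e0.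
have e2 : 0 < e ^+ 2 by rewrite exprn_gt0.
move/(@cvgr0Pnorm_lt _ R^o) : u0 => /(_ _ e2); apply: filterS => x.
by rewrite normrX ltr_sqr ?nnegrE // ltW.
Qed.

Lemma cvg_sqr (u : T -> R) (l : R) :
  u x @[x --> F] --> l -> u x ^+ 2 @[x --> F] --> l ^+ 2.
Proof. by move=> ul; exact: cvgM. Qed.

Lemma norm_squeeze0 (u v : T -> R) :
  (\forall x \near F, `|u x| <= v x) -> v x @[x --> F] --> (0 : R) ->
  u x @[x --> F] --> (0 : R).
Proof.
move=> uv v0; apply: cvg_sqr0; apply: (@squeeze0 _ (fun x => v x ^+ 2)).
  apply: filterS uv => x uvx; rewrite sqr_ge0 -[leLHS]real_normK ?num_real//=.
  by rewrite ler_sqr ?nnegrE // (le_trans _ uvx).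
by have := cvg_sqr v0; rewrite expr0n.
Qed.

Lemma cvgDr0 (u v : T -> R) (l : R) : u x @[x --> F] --> l ->
  v x @[x --> F] --> (0 : R) -> u x + v x @[x --> F] --> l.
Proof. by move=> ul /(@cvgD _ R^o _ _ _ _ _ _ _ ul); rewrite addr0; apply. Qed.

Lemma cvgBr0 (u v : T -> R) (l : R) : u x @[x --> F] --> l ->
  v x @[x --> F] --> (0 : R) -> u x - v x @[x --> F] --> l.
Proof. by move=> ul /(@cvgB _ R^o _ _ _ _ _ _ _ ul); rewrite subr0; apply. Qed.

Lemma cvg_gap0 (u : T -> R) (l : R) : u x @[x --> F] --> l ->
  l - u x @[x --> F] --> (0 : R).
Proof.
move=> ul; rewrite -(subrr l).
by apply: (@cvgB _ R^o _ _ _ (fun=> l)) ul; exact: cvg_cst.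
Qed.

Lemma cvgM0 (u v : T -> R) (l : R) : u x @[x --> F] --> l ->
  v x @[x --> F] --> (0 : R) -> u x * v x @[x --> F] --> (0 : R).
Proof. by move=> u0 /(cvgM u0); rewrite mulr0; apply. Qed.

Lemma cvg_sqr_0 (u : T -> R) :
  u x @[x --> F] --> (0 : R) -> u x ^+ 2 @[x --> F] --> (0 : R).
Proof. by move=> /cvg_sqr; rewrite expr0n. Qed.

Lemma cvg_nat_sum (a b : nat) (u : nat -> T -> R) (l : nat -> R) :
  (forall i, (a <= i < b)%N -> u i x @[x --> F] --> l i) ->
  \sum_(a <= i < b) u i x @[x --> F] --> \sum_(a <= i < b) l i.
Proof.
move=> ul; rewrite big_nat.
have -> : (fun x => \sum_(a <= i < b) u i x) =
    fun x => \sum_(a <= i < b | (a <= i < b)%N) u i x.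
  by apply/funext => x; rewrite big_nat.
elim: (index_iota a b) => [|i r IH].
  rewrite big_nil (_ : (fun x => _) = fun=> 0); first exact: cvg_cst.
  by apply/funext => x; rewrite big_nil.
rewrite big_cons (_ : (fun x => _) = fun x => if (a <= i < b)%N then
    u i x + \sum_(j <- r | (a <= j < b)%N) u j x
    else \sum_(j <- r | (a <= j < b)%N) u j x); last first.
  by apply/funext => x; rewrite big_cons.
by case: ifP => // /ul ui; exact: (@cvgD _ R^o _ _ _ _ _ _ _ ui IH).
Qed.

Lemma cvg_nat_sum0 (a b : nat) (u : nat -> T -> R) :
  (forall i, (a <= i < b)%N -> u i x @[x --> F] --> (0 : R)) ->
  \sum_(a <= i < b) u i x @[x --> F] --> (0 : R).
Proof. by move=> /cvg_nat_sum; rewrite big1_eq. Qed.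

Lemma near_nat_range (a b : nat) (p : nat -> T -> Prop) :
  (forall i, (a <= i < b)%N -> \forall x \near F, p i x) ->
  \forall x \near F, forall i, (a <= i < b)%N -> p i x.
Proof.
elim: b => [|b IH] pi.
  by apply: filterE => x i; rewrite ltn0 andbF.
have [ab|ba] := leqP a b; last first.
  apply: filterE => x i /andP[ai ib]; exfalso; move: ba; rewrite ltnNge.
  by rewrite (leq_trans ai).
have {}IH : \forall x \near F, forall i, (a <= i < b)%N -> p i x.
  by apply: IH => i /andP[ai /ltnW ib]; apply: pi; rewrite ai.
have pb : \forall x \near F, p b x by apply: pi; rewrite ab leqnn.
apply: filterS2 pb IH => x pbx IHx i /andP[ai].
by rewrite ltnS leq_eqVlt => /predU1P[->//|ib]; apply: IHx; rewrite ai.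
Qed.

Lemma cvg_of_norm_sub0 (V : normedModType R) (u : T -> V) (l : V) :
  `|u x - l| @[x --> F] --> (0 : R) -> u x @[x --> F] --> l.
Proof.
move=> /(@cvgr0Pnorm_lt _ R^o) ul; apply/cvgrPdist_lt => e /ul.
by apply: filterS => x; rewrite normr_id distrC.
Qed.

End real_sequences.

(** * Operators that are linear on a subspace *)

Section linear_on_sums.
Context {R : realType} {H : hilbertType R} (S : set H) (L : H -> H).
Hypotheses (S_lin : linear_subset S) (L_lin : linear_on S L).

Lemma linear_on0 : L 0 = 0.
Proof.
have [S0 _] := S_lin; have := L_lin 1 S0 S0.
by rewrite !scale1r addr0 => /(congr1 (+%R (- L 0))); rewrite addNr addKr.
Qed.

Lemma linear_onZ c x : S x -> S (c *: x) /\ L (c *: x) = c *: L x.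
Proof.
have [S0 SD] := S_lin => Sx; rewrite -[c *: x]addr0; split; first exact: SD.
by rewrite L_lin // linear_on0 addr0.
Qed.

Lemma linear_on_sum (r : seq nat) (p : pred nat) (c : nat -> R) (x : nat -> H) :
  (forall i, p i -> S (x i)) ->
  S (\sum_(i <- r | p i) c i *: x i) /\
  L (\sum_(i <- r | p i) c i *: x i) = \sum_(i <- r | p i) c i *: L (x i).
Proof.
have [S0 SD] := S_lin => Sx.
elim: r => [|i r [IHS IHL]]; first by rewrite !big_nil linear_on0.
rewrite !big_cons; case: ifP => // pi.
by split; [exact/SD/IHS/Sx|rewrite L_lin ?IHL//; exact: Sx].
Qed.

End linear_on_sums.

(** * Directions of maximal scale *)

Section best_directions.
Context {R : realType} {H : hilbertType R} (s : H -> R) (phi : nat -> H).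
Hypotheses (s_ge0 : forall x, 0 <= s x)
  (s_hom : forall c x, s (c *: x) = `|c| * s x).

Lemma argmax_orthonormal q :
  (forall m, (1 <= m <= q)%N -> is_argmax (sphere_orth phi m) s (phi m)) ->
  forall i j, (1 <= i <= q)%N -> (1 <= j <= q)%N ->
  inner (phi i) (phi j) = (i == j)%:R.
Proof.
move=> best i j iq jq; have [[i1 iO] _] := best i iq.
have [[j1 jO] _] := best j jq.
have [/andP[i0 _] /andP[j0 _]] := (iq, jq).
case: (ltngtP i j) => [ij|ji|<-]; last by rewrite inner_norm i1 expr1n.
- by rewrite innerC jO // i0.
- by rewrite iO // j0.
Qed.

Lemma argmax_bound m x : is_argmax (sphere_orth phi m) s (phi m) ->
  (forall j, (1 <= j < m)%N -> inner x (phi j) = 0) ->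
  s x <= `|x| * s (phi m).
Proof.
move=> [_ best] xO; have [->|x0] := eqVneq x 0.
  by rewrite normr0 mul0r -(scale0r (0 : H)) s_hom normr0 mul0r.
have nx : 0 < `|x| by rewrite normr_gt0.
have -> : s x = `|x| * s (`|x|^-1 *: x).
  by rewrite s_hom normfV normr_id mulVKf // gt_eqF.
rewrite ler_pM2l //; apply: best; split.
  by rewrite normrZ normfV normr_id mulVf // gt_eqF.
by move=> j jm; rewrite innerZl xO // mulr0.
Qed.

Lemma unique_argmax_attained m x :
  is_argmax (sphere_orth phi m) s (phi m) ->
  (forall a, is_argmax (sphere_orth phi m) s a -> a = phi m \/ a = - phi m) ->
  0 < s (phi m) -> `|x| <= 1 ->
  (forall j, (1 <= j < m)%N -> inner x (phi j) = 0) ->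
  s x = s (phi m) -> inner x (phi m) ^+ 2 = 1.
Proof.
move=> best uniq pos x1 xO sx.
have nx : `|x| = 1.
  apply/eqP; rewrite eq_le x1 /= -(ler_pM2r pos) mul1r -{1}sx.
  exact: argmax_bound.
have n1 : `|phi m| = 1 by case: best => -[].
have [|->|->] := uniq x.
- by split=> [//|y /best.2]; rewrite sx.
- by rewrite inner_norm n1 !expr1n.
- by rewrite innerNl sqrrN inner_norm n1 !expr1n.
Qed.

(** When the m-th maximum is 0, every unit vector orthogonal to the earlier
directions attains it.  Uniqueness up to sign thus leaves no room in H for a vector
orthogonal to the first m directions. *)
Lemma null_argmax_span q m :
  (forall m, (1 <= m <= q)%N -> is_argmax (sphere_orth phi m) s (phi m)) ->
  (1 <= m <= q)%N ->
  (forall a, is_argmax (sphere_orth phi m) s a -> a = phi m \/ a = - phi m) ->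
  s (phi m) = 0 ->
  forall x, x = \sum_(1 <= j < m.+1) inner x (phi j) *: phi j.
Proof.
move=> best mq uniq s0 x.
pose y := x - \sum_(1 <= j < m.+1) inner x (phi j) *: phi j.
have yO k : (1 <= k < m.+1)%N -> inner y (phi k) = 0.
  move=> km; have /andP[k1 k2] := km; have /andP[m1 m2] := mq.
  have kq : (1 <= k <= q)%N by rewrite k1 (leq_trans _ m2).
  rewrite innerBl inner_suml (big_rem k) /=; last by rewrite mem_index_iota.
  rewrite innerZl (argmax_orthonormal best) // eqxx mulr1.
  rewrite big_seq_cond big1 ?addr0 ?subrr // => j; rewrite andbT.
  rewrite mem_rem_uniq ?iota_uniq // inE mem_index_iota => /andP[jk /andP[j1 j2]].
  rewrite innerZl (argmax_orthonormal best) // ?(negbTE jk) ?mulr0 //.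
  by rewrite j1 (leq_trans _ m2).
apply/eqP; rewrite -subr_eq0; apply/negPn/negP => y0.
have ny : `|y| != 0 by rewrite normr_eq0.
have zmax : is_argmax (sphere_orth phi m) s (`|y|^-1 *: y).
  split.
    split; first by rewrite normrZ normfV normr_id mulVf.
    move=> j /andP[j1 jm]; rewrite innerZl yO ?mulr0 //.
    by rewrite j1 (ltn_trans jm).
  move=> z /(best m mq).2; rewrite s0 => /le_trans; apply; exact: s_ge0.
have zphi : inner (`|y|^-1 *: y) (phi m) = 0.
  by rewrite innerZl yO ?mulr0 // ltnSn; case/andP: mq => ->.
have nphi := argmax_orthonormal best mq mq.
have := uniq _ zmax; case=> zE; move: zphi; rewrite zE ?innerNl nphi eqxx => /eqP.
  by rewrite oner_eq0.
by rewrite oppr_eq0 oner_eq0.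
Qed.

End best_directions.

(** * Sequences that align with a direction up to sign *)

(** Signs are not controlled, so alignment of x_n with the unit vector p is
expressed by <x_n, p>^2 -> 1; then x_n - <x_n, p> p tends to 0 in norm. *)
Section almost_aligned.
Context {R : realType} {H : hilbertType R} (x : nat -> H) (p : H).
Hypotheses (p1 : `|p| = 1) (x1 : \forall n \near \oo, `|x n| <= 1)
  (xp : inner (x n) p ^+ 2 @[n --> \oo] --> (1 : R)).

Let one_minus : 1 - inner (x n) p ^+ 2 @[n --> \oo] --> (0 : R).
Proof. exact: cvg_gap0. Qed.

Lemma aligned_residual :
  `|x n - inner (x n) p *: p| @[n --> \oo] --> (0 : R).
Proof.
apply: cvg_sqr0; apply: squeeze0 one_minus.
apply: filterS x1 => n xn; rewrite sqr_ge0 /= innerB_norm p1 expr1n mulr1.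
have : `|x n| ^+ 2 <= 1 by rewrite expr_le1.
rewrite mulr2n; nra.
Qed.

Lemma aligned_norm : `|x n| @[n --> \oo] --> (1 : R).
Proof.
apply: (squeeze_cvgr (f := fun n => inner (x n) p ^+ 2) (h := fun=> 1)) xp _.
  apply: filterS x1 => n xn; rewrite xn andbT.
  apply: le_trans (inner_sqr_le _ _) _; rewrite p1 expr1n mulr1.
  by rewrite expr2 ler_piMr.
exact: cvg_cst.
Qed.

Lemma aligned_orth (z : nat -> H) :
  (\forall n \near \oo, `|z n| <= 1) ->
  inner (z n) (x n) @[n --> \oo] --> (0 : R) ->
  inner (z n) p @[n --> \oo] --> (0 : R).
Proof.
move=> z1 zx; pose c n := inner (x n) p.
have cz : c n * inner (z n) p @[n --> \oo] --> (0 : R).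
  have -> : (fun n => c n * inner (z n) p) =
      (fun n => inner (z n) (x n) - inner (z n) (x n - c n *: p)).
    by apply/funext => n; rewrite innerBr innerZr; ring.
  apply: cvgBr0 => //.
  apply: norm_squeeze0 aligned_residual; apply: filterS z1 => n zn.
  by apply: le_trans (cauchy_schwarz _ _) _; rewrite ler_piMl.
apply: cvg_sqr0.
have : (c n * inner (z n) p) ^+ 2 + (1 - c n ^+ 2) @[n --> \oo] --> (0 : R).
  by apply: cvgDr0 one_minus; exact: cvg_sqr_0.
apply: squeeze0; near=> n; rewrite sqr_ge0 /=.
have zp : inner (z n) p ^+ 2 <= 1.
  apply: le_trans (inner_sqr_le _ _) _; rewrite p1 expr1n mulr1 expr_le1 //.
  by near: n.
have cn : c n ^+ 2 <= 1.
  apply: le_trans (inner_sqr_le _ _) _; rewrite p1 expr1n mulr1 expr_le1 //.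
  by near: n.
have := sqr_ge0 (inner (z n) p); move: zp cn; rewrite exprMn.
set a := inner _ _ ^+ 2; set b := c n ^+ 2; nra.
Unshelve. all: by end_near. Qed.

Lemma orth_aligned (y : H) : inner y p = 0 ->
  inner y (x n) @[n --> \oo] --> (0 : R).
Proof.
move=> yp; have : `|y| * `|x n - inner (x n) p *: p| @[n --> \oo] --> (0 : R).
  by apply: cvgM0 aligned_residual; exact: cvg_cst.
apply: norm_squeeze0; apply: nearW => n.
apply: le_trans (cauchy_schwarz _ _).
by rewrite innerBr innerZr yp mulr0 subr0.
Qed.

End almost_aligned.

(** * From the unit sphere to bounded sequences *)

Section uniform_scale.
Context {R : realType} {H : hilbertType R} (s : H -> R) (sn : nat -> H -> R).
Hypotheses (s_hom : forall c x, s (c *: x) = `|c| * s x)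
  (sn_hom : forall n c x, sn n (c *: x) = `|c| * sn n x)
  (sn_unif : forall e : R, 0 < e -> \forall n \near \oo, forall a : H,
    `|a| = 1 -> `|sn n a ^+ 2 - s a ^+ 2| <= e).

Lemma scale_gap_bounded (x : nat -> H) (M : R) :
  (\forall n \near \oo, `|x n| <= M) ->
  sn n (x n) ^+ 2 - s (x n) ^+ 2 @[n --> \oo] --> (0 : R).
Proof.
move=> xM; apply/(@cvgr0Pnorm_le _ R^o) => e e0.
have M1 : 0 < M ^+ 2 + 1 by rewrite ltr_wpDl // sqr_ge0.
have := sn_unif (divr_gt0 e0 M1); apply: filterS2 xM => n xn snn.
have [->|x0] := eqVneq (x n) 0.
  by rewrite -(scale0r (0 : H)) sn_hom s_hom normr0 !mul0r subrr normr0 ltW.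
have nx : `|x n| != 0 by rewrite normr_eq0.
pose u := `|x n|^-1 *: x n.
have u1 : `|u| = 1 by rewrite normrZ normfV normr_id mulVf.
have -> : x n = `|x n| *: u by rewrite scalerA divff // scale1r.
rewrite sn_hom s_hom normr_id !exprMn -mulrBr normrM normrX normr_id.
have /snn h := u1; apply: (@le_trans _ _ ((M ^+ 2 + 1) * (e / (M ^+ 2 + 1)))).
  apply: ler_pM => //; rewrite ?sqr_ge0 //.
  apply: le_trans (_ : M ^+ 2 <= _); last by rewrite lerDl.
  by rewrite ler_sqr ?nnegrE // (le_trans _ xn).
by rewrite mulrCA divff ?mulr1 // gt_eqF.
Qed.

End uniform_scale.

(** * Consistency of the smoothed directions along one path *)

(** In this section h n m is the m-th estimated direction at stage n.  The operators
A n and C n carry the two penalties: |A n x|^2 is the one of the norm and |C n x|^2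
the one of the objective. *)
Section smoothed_directions.
Context {R : realType} {H : hilbertType R}.
Context (s : H -> R) (phi : nat -> H) (q : nat).
Hypotheses (s_ge0 : forall x, 0 <= s x)
  (s_hom : forall c x, s (c *: x) = `|c| * s x)
  (s_weak : continuous (s : weak_space H -> R))
  (best : forall m, (1 <= m <= q)%N ->
     is_argmax (sphere_orth phi m) s (phi m))
  (uniq : forall m, (1 <= m <= q)%N -> forall a,
     is_argmax (sphere_orth phi m) s a -> a = phi m \/ a = - phi m).

Context (sn : nat -> H -> R).
Hypotheses (sn_hom : forall n c x, sn n (c *: x) = `|c| * sn n x)
  (sn_unif : forall e : R, 0 < e -> \forall n \near \oo, forall a : H,
    `|a| = 1 -> `|sn n a ^+ 2 - s a ^+ 2| <= e).

Context (S : nat -> set H) (A C : nat -> H -> H).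
Hypotheses (S_lin : forall n, linear_subset (S n))
  (A_lin : forall n, linear_on (S n) (A n))
  (C_lin : forall n, linear_on (S n) (C n))
  (S_phi : \forall n \near \oo, forall j, (1 <= j <= q)%N -> S n (phi j))
  (A_phi : forall j, (1 <= j <= q)%N ->
     `|A n (phi j)| @[n --> \oo] --> (0 : R))
  (C_phi : forall j, (1 <= j <= q)%N ->
     `|C n (phi j)| @[n --> \oo] --> (0 : R)).

(** The inner product of the graph of A n, that is of (x, A n x) and (y, A n y) in
the Hilbert sum of two copies of H. *)
Definition graph_inner n (x y : H) : R := inner x y + inner (A n x) (A n y).

Definition penalized n (x : H) : R := sn n x ^+ 2 - `|C n x| ^+ 2.

Context (h : nat -> nat -> H).

Definition graph_feasible n m (x : H) := [/\ S n x, graph_inner n x x = 1 &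
  forall j, (1 <= j < m)%N -> graph_inner n x (h n j) = 0].

Hypothesis opt : forall n m y, (1 <= m <= q)%N -> graph_feasible n m y ->
  graph_feasible n m (h n m) /\ penalized n y <= penalized n (h n m).

(** The induction hypothesis.  It does not fix signs, which the orthogonality
constraints do not see. *)
Definition recovered m := [/\ \forall n \near \oo, graph_feasible n m (h n m),
  `|A n (h n m)| @[n --> \oo] --> (0 : R),
  `|C n (h n m)| @[n --> \oo] --> (0 : R) &
  inner (h n m) (phi m) ^+ 2 @[n --> \oo] --> (1 : R)].

Lemma graph_innerC n x y : graph_inner n x y = graph_inner n y x.
Proof. by rewrite /graph_inner innerC [X in _ + X]innerC. Qed.

Lemma graph_inner_norm n x :
  graph_inner n x x = `|x| ^+ 2 + `|A n x| ^+ 2.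
Proof. by rewrite /graph_inner !inner_norm. Qed.

Lemma feasible_norm_le1 n m x : graph_feasible n m x ->
  `|x| <= 1 /\ `|A n x| <= 1.
Proof.
move=> [_ + _]; rewrite graph_inner_norm => e.
have := sqr_ge0 `|x|; have := sqr_ge0 `|A n x| => a b.
split; rewrite -(@expr_le1 _ 2) //; lra.
Qed.

Lemma phi_norm j : (1 <= j <= q)%N -> `|phi j| = 1.
Proof. by move=> /best[[]]. Qed.

Section step.
Context (m : nat).
Hypotheses (mq : (1 <= m <= q)%N)
  (IH : forall l, (1 <= l < m)%N -> recovered l).

Let lq l : (1 <= l < m)%N -> (1 <= l <= q)%N.
Proof.
move=> /andP[-> lm] /=; case/andP: mq => _; exact: leq_trans (ltnW lm).
Qed.

Let IH_feas : \forall n \near \oo, forall l, (1 <= l < m)%N ->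
  graph_feasible n l (h n l).
Proof. by apply: near_nat_range => l /IH[]. Qed.

Let IH_norm l : (1 <= l < m)%N -> \forall n \near \oo, `|h n l| <= 1.
Proof.
by move=> lm; apply: filterS IH_feas => n /(_ l lm) /feasible_norm_le1[].
Qed.

Let phi_orth l : (1 <= l < m)%N -> inner (phi m) (phi l) = 0.
Proof. by move=> lm; have [[_ o] _] := best mq; exact: o. Qed.

(* the coefficients of the Gram-Schmidt correction of phi m; they tend to 0
   because phi m is orthogonal to the limits of the h n l *)
Let b n l := graph_inner n (phi m) (h n l).

Let b_cvg l : (1 <= l < m)%N -> `|b n l| @[n --> \oo] --> (0 : R).
Proof.
move=> lm; have [_ Ah _ hp] := IH lm.
have u0 : inner (phi m) (h n l) @[n --> \oo] --> (0 : R).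
  exact: (orth_aligned (phi_norm (lq lm)) (IH_norm lm) hp (phi_orth lm)).
have v0 : inner (A n (phi m)) (A n (h n l)) @[n --> \oo] --> (0 : R).
  apply: norm_squeeze0 (cvgM0 (A_phi mq) Ah); apply: nearW => n.
  exact: cauchy_schwarz.
have : b n l @[n --> \oo] --> (0 : R) by exact: cvgDr0.
by move/(@cvg_norm _ R^o); rewrite normr0.
Qed.

Let corr n := \sum_(1 <= l < m) b n l *: h n l.
Let v n := phi m - corr n.

Let near_v : \forall n \near \oo,
  [/\ S n (v n), A n (v n) = A n (phi m) - \sum_(1 <= l < m) b n l *: A n (h n l)
    & C n (v n) = C n (phi m) - \sum_(1 <= l < m) b n l *: C n (h n l)].
Proof.
apply: filterS2 S_phi IH_feas => n Sp Sh.
have Sphi := Sp m mq.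
have Sh' l : (1 <= l < m)%N -> S n (h n l) by move=> /Sh[].
have -> : v n = (-1) *: corr n + phi m by rewrite scaleN1r addrC.
have [SC AC] := linear_on_sum (S_lin n) (@A_lin n) (index_iota 1 m) (b n) Sh'.
have [_ CC] := linear_on_sum (S_lin n) (@C_lin n) (index_iota 1 m) (b n) Sh'.
rewrite /corr big_nat; split; first exact: (S_lin n).2.
- by rewrite A_lin // AC scaleN1r addrC -big_nat.
- by rewrite C_lin // CC scaleN1r addrC -big_nat.
Qed.

Let weighted_sum_cvg (x : nat -> nat -> H) :
  (forall l, (1 <= l < m)%N -> \forall n \near \oo, `|x n l| <= 1) ->
  `|\sum_(1 <= l < m) b n l *: x n l| @[n --> \oo] --> (0 : R).
Proof.
move=> x1; have : \sum_(1 <= l < m) `|b n l| @[n --> \oo] --> (0 : R).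
  exact: cvg_nat_sum0.
apply: squeeze0; apply: filterS (near_nat_range x1) => n xn; rewrite normr_ge0 /=.
apply: le_trans (ler_norm_sum _ _ _) _; rewrite [leLHS]big_nat [leRHS]big_nat.
by apply: ler_sum => l lm; rewrite normrZ ler_piMr // xn.
Qed.

Let v_cvg : v n @[n --> \oo] --> phi m.
Proof.
apply: cvg_of_norm_sub0; apply: squeeze0 (weighted_sum_cvg IH_norm).
by apply: nearW => n; rewrite normr_ge0 /v addrAC subrr add0r normrN /corr lexx.
Qed.

Let Av_cvg : `|A n (v n)| @[n --> \oo] --> (0 : R).
Proof.
have A1 l : (1 <= l < m)%N -> \forall n \near \oo, `|A n (h n l)| <= 1.
  by move=> lm; apply: filterS IH_feas => n /(_ l lm) /feasible_norm_le1[].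
apply: squeeze0 (cvgDr0 (A_phi mq) (weighted_sum_cvg A1)).
apply: filterS near_v => n [_ -> _].
by rewrite normr_ge0 ler_normB.
Qed.

Let Cv_cvg : `|C n (v n)| @[n --> \oo] --> (0 : R).
Proof.
have C1 l : (1 <= l < m)%N -> \forall n \near \oo, `|C n (h n l)| <= 1.
  move=> /IH[_ _ + _] => /(@cvgr_norm_le _ R^o) => /(_ 1); rewrite normr0.
  by move=> /(_ ltr01); apply: filterS => n; rewrite normr_id.
apply: squeeze0 (cvgDr0 (C_phi mq) (weighted_sum_cvg C1)).
apply: filterS near_v => n [_ _ ->].
by rewrite normr_ge0 ler_normB.
Qed.

Let v_orth : \forall n \near \oo, forall k, (1 <= k < m)%N ->
  graph_inner n (v n) (h n k) = 0.
Proof.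
apply: filterS2 IH_feas near_v => n Sh [_ Av _] k km.
have /andP[k1 k2] := km.
have hh l : (1 <= l < m)%N -> graph_inner n (h n l) (h n k) = (l == k)%:R.
  move=> lm; have /andP[l1 l2] := lm; case: (ltngtP l k) => [lk|kl|->].
  - by rewrite graph_innerC; case: (Sh k km) => _ _; apply; rewrite l1.
  - by case: (Sh l lm) => _ _; apply; rewrite k1.
  - by case: (Sh k km).
rewrite /graph_inner Av !innerBl !inner_suml.
rewrite addrACA -/(graph_inner n (phi m) (h n k)) -opprD.
rewrite -big_split /= big_nat (eq_bigr (fun l => b n l * (l == k)%:R)); last first.
  by move=> l lm; rewrite !innerZl -mulrDr -/(graph_inner n _ _) hh.
rewrite -big_nat (big_rem k) /=; last by rewrite mem_index_iota.
rewrite eqxx mulr1 big_seq big1 ?addr0 ?subrr // => j.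
by rewrite mem_rem_uniq ?iota_uniq // inE => /andP[/negbTE -> _]; rewrite mulr0.
Qed.

Let size_v n := graph_inner n (v n) (v n).

Let size_v_cvg : size_v n @[n --> \oo] --> (1 : R).
Proof.
have -> : size_v = fun n => `|v n| ^+ 2 + `|A n (v n)| ^+ 2.
  by apply/funext => n; rewrite /size_v graph_inner_norm.
have v1 : `|v n| ^+ 2 @[n --> \oo] --> (1 : R).
  rewrite -[X in _ --> X](expr1n _ 2) -(phi_norm mq).
  by apply: cvg_sqr; exact: cvg_norm.
have A0 : `|A n (v n)| ^+ 2 @[n --> \oo] --> (0 : R) by exact: cvg_sqr_0.
exact: cvgDr0.
Qed.

Let size_v_gt0 : \forall n \near \oo, 0 < size_v n.
Proof. by apply: (cvgr_gt 1). Qed.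

Let y n := (Num.sqrt (size_v n))^-1 *: v n.

Let near_y : \forall n \near \oo,
  graph_feasible n m (y n) /\ penalized n (y n) = penalized n (v n) / size_v n.
Proof.
apply: filterS3 size_v_gt0 near_v v_orth => n v0 [Sv _ _] vo.
set c := (Num.sqrt (size_v n))^-1.
have cE : c ^+ 2 = (size_v n)^-1 by rewrite exprVn sqr_sqrtr // ltW.
have [Sy Ay] := linear_onZ (S_lin n) (@A_lin n) c Sv.
have [_ Cy] := linear_onZ (S_lin n) (@C_lin n) c Sv.
split.
  split=> //.
    rewrite graph_inner_norm Ay !normrZ !exprMn -mulrDr -graph_inner_norm.
    by rewrite real_normK ?num_real // cE mulVf // gt_eqF.
  move=> j jm; rewrite /graph_inner Ay !innerZl -mulrDr.
  by rewrite -/(graph_inner n _ _) vo // mulr0.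
rewrite /penalized Cy sn_hom normrZ !exprMn -mulrBr real_normK ?num_real //.
by rewrite cE mulrC.
Qed.

Let h_feas : \forall n \near \oo, graph_feasible n m (h n m) /\
  penalized n (v n) / size_v n <= penalized n (h n m).
Proof.
by apply: filterS near_y => n [yf <-]; exact: opt.
Qed.

Let h_norm : \forall n \near \oo, `|h n m| <= 1.
Proof. by apply: filterS h_feas => n [/feasible_norm_le1[]]. Qed.

Let lower : penalized n (v n) / size_v n @[n --> \oo] --> s (phi m) ^+ 2.
Proof.
rewrite -[X in _ --> X]divr1; apply: cvgM; last first.
  by apply: cvgV => //; exact: oner_neq0.
have -> : (fun n => penalized n (v n)) = (fun n => s (v n) ^+ 2 +
    ((sn n (v n) ^+ 2 - s (v n) ^+ 2) - `|C n (v n)| ^+ 2)).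
  by apply/funext => n; rewrite /penalized; ring.
apply: cvgDr0.
  have sw : s a @[a --> (phi m : weak_space H)] --> s (phi m) by exact: s_weak.
  by apply: cvg_sqr; exact: cvg_trans (cvg_app s (cvg_weak v_cvg)) sw.
apply: cvgBr0; last exact: cvg_sqr_0.
apply: (scale_gap_bounded s_hom sn_hom sn_unif (M := 2)).
apply: (cvgr_norm_le (phi m) v_cvg).
by rewrite phi_norm // ltr1n.
Qed.

(* graph orthogonality to h n l is almost orthogonality in H since A n (h n l)
   vanishes, and h n l is aligned with phi l *)
Let h_orth l : (1 <= l < m)%N -> inner (h n m) (phi l) @[n --> \oo] --> (0 : R).
Proof.
move=> lm; have [_ Ah _ hp] := IH lm.
apply: (aligned_orth (phi_norm (lq lm)) (IH_norm lm) hp h_norm).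
apply: norm_squeeze0 Ah; apply: filterS h_feas => n [hf _].
have [_ An] := feasible_norm_le1 hf; case: hf => _ _ /(_ l lm).
rewrite /graph_inner => /eqP; rewrite addr_eq0 => /eqP ->; rewrite normrN.
by apply: le_trans (cauchy_schwarz _ _) _; rewrite ler_piMl.
Qed.

Let off n := \sum_(1 <= l < m) inner (h n m) (phi l) ^+ 2.

Let off_cvg : off n @[n --> \oo] --> (0 : R).
Proof. by apply: cvg_nat_sum0 => l lm; apply: cvg_sqr_0; exact: h_orth. Qed.

Let weak_sqr_inner (z : H) :
  continuous (fun a : weak_space H => inner (a : H) z ^+ 2 : R).
Proof.
move=> a; apply: (@cvg_sqr R _ _ (nbhs_filter a)).
have -> : (fun x : weak_space H => inner (x : H) z) = inner z.
  by apply/funext => x; rewrite innerC.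
by rewrite innerC; exact: weak_continuous_inner.
Qed.

Let weak_off :
  continuous (fun a : weak_space H =>
    \sum_(1 <= l < m) inner (a : H) (phi l) ^+ 2 : R).
Proof.
move=> a; apply: (@cvg_nat_sum R _ _ (nbhs_filter a)) => l _.
exact: weak_sqr_inner.
Qed.

Let off0 (a : H) : \sum_(1 <= l < m) inner a (phi l) ^+ 2 = 0 ->
  forall l, (1 <= l < m)%N -> inner a (phi l) = 0.
Proof.
move=> /eqP; rewrite psumr_eq0 => [/allP a0 l lm|l _]; last exact: sqr_ge0.
by have := a0 l; rewrite mem_index_iota lm sqrf_eq0 => /(_ isT) /eqP.
Qed.

Let weak_sqr_gap :
  continuous (fun a : weak_space H => s a ^+ 2 - s (phi m) ^+ 2 : R).
Proof.
move=> a; apply: (@cvgB _ R^o _ _ (nbhs_filter a) _ (fun=> s (phi m) ^+ 2)).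
  by apply: (@cvg_sqr R _ _ (nbhs_filter a)); exact: s_weak.
exact: cvg_cst.
Qed.

(* twice the positive part of x, a continuous function of x *)
Let pos2 (x : R) := x + `|x|.

Let weak_excess : continuous (fun a : weak_space H =>
  pos2 (s a ^+ 2 - s (phi m) ^+ 2) : R).
Proof.
move=> a; apply: (@cvgD _ R^o _ _ (nbhs_filter a)); first exact: weak_sqr_gap.
by apply: (@cvg_norm _ R^o _ _ (nbhs_filter a)); exact: weak_sqr_gap.
Qed.

Let excess n := pos2 (s (h n m) ^+ 2 - s (phi m) ^+ 2).

Let excess_cvg : excess n @[n --> \oo] --> (0 : R).
Proof.
apply: (weak_compact_transfer weak_off weak_excess h_norm off_cvg).
move=> a a1 /off0 aO; rewrite /pos2 ler0_norm ?subrr // subr_le0.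
rewrite ler_sqr ?nnegrE //; apply: le_trans (argmax_bound s_hom (best mq) aO) _.
by rewrite ler_piMl.
Qed.

Let gap n := sn n (h n m) ^+ 2 - s (h n m) ^+ 2.

Let gap_cvg : gap n @[n --> \oo] --> (0 : R).
Proof. exact: (scale_gap_bounded s_hom sn_hom sn_unif h_norm). Qed.

Let slack n := s (phi m) ^+ 2 - penalized n (v n) / size_v n.

Let slack_cvg : slack n @[n --> \oo] --> (0 : R).
Proof. exact: cvg_gap0. Qed.

Let scale_le_excess n : s (h n m) ^+ 2 <= s (phi m) ^+ 2 + excess n.
Proof. by rewrite -lerBlDl /excess /pos2 lerDl. Qed.

(** |C h|^2 is the difference between the squared empirical scale of h, almost at
most s(phi m)^2, and the optimal value, almost at least s(phi m)^2. *)
Lemma objective_penalty_vanishes : `|C n (h n m)| @[n --> \oo] --> (0 : R).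
Proof.
apply: cvg_sqr0; apply: squeeze0 (cvgDr0 (cvgDr0 excess_cvg gap_cvg) slack_cvg).
apply: filterS h_feas => n [_]; have := scale_le_excess n.
rewrite sqr_ge0 /slack /gap /=.
by set L := _ / _; rewrite /penalized; lra.
Qed.

Lemma empirical_scale_cvg : sn n (h n m) ^+ 2 @[n --> \oo] --> s (phi m) ^+ 2.
Proof.
have : sn n (h n m) ^+ 2 - s (phi m) ^+ 2 @[n --> \oo] --> (0 : R).
  apply: (squeeze_cvgr (f := fun n => - slack n) (h := fun n => excess n + gap n)).
  - apply: filterS h_feas => n [_]; have := scale_le_excess n.
    have := sqr_ge0 `|C n (h n m)|; rewrite /slack /gap.
    set L := _ / _; rewrite /penalized => c0 c1 c2; apply/andP; split; lra.
  - by rewrite -oppr0; exact: (@cvgN _ R^o).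
  - exact: cvgDr0.
move=> u; apply: cvg_of_norm_sub0; rewrite -(@normr0 _ R).
exact: (@cvg_norm _ R^o).
Qed.

Lemma population_scale_cvg : s (h n m) ^+ 2 @[n --> \oo] --> s (phi m) ^+ 2.
Proof.
have -> : (fun n => s (h n m) ^+ 2) = (fun n => sn n (h n m) ^+ 2 - gap n).
  by apply/funext => n; rewrite /gap; ring.
exact: cvgBr0 empirical_scale_cvg gap_cvg.
Qed.

Lemma direction_cvg_pos : 0 < s (phi m) ->
  inner (h n m) (phi m) ^+ 2 @[n --> \oo] --> (1 : R).
Proof.
move=> pos.
have c1 : continuous (fun a : weak_space H =>
    \sum_(1 <= l < m) inner (a : H) (phi l) ^+ 2 +
    (s a ^+ 2 - s (phi m) ^+ 2) ^+ 2 : R).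
  move=> a; apply: (@cvgD _ R^o _ _ (nbhs_filter a)); first exact: weak_off.
  by apply: (@cvg_sqr R _ _ (nbhs_filter a)); exact: weak_sqr_gap.
have c0 : off n + (s (h n m) ^+ 2 - s (phi m) ^+ 2) ^+ 2 @[n --> \oo] --> (0 : R).
  apply: cvgDr0 => //; apply: cvg_sqr_0; rewrite -oppr0.
  under eq_fun do rewrite -opprB.
  by apply: (@cvgN _ R^o); apply: cvg_gap0; exact: population_scale_cvg.
apply: (weak_compact_transfer c1 (@weak_sqr_inner (phi m)) h_norm c0).
move=> a a1 /eqP; rewrite paddr_eq0 ?sqr_ge0 ?sumr_ge0 //; last first.
  by move=> l _; exact: sqr_ge0.
move=> /andP[/eqP /off0 aO]; rewrite sqrf_eq0 subr_eq0 eqrXn2 // => /eqP sa.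
exact: (unique_argmax_attained s_hom (best mq) (uniq mq)).
Qed.

(** The space is spanned by phi 1, .., phi m here, so A n (h n m) is a combination
of the A n (phi j) with coefficients bounded by 1. *)
Lemma norm_penalty_vanishes_null : s (phi m) = 0 ->
  `|A n (h n m)| @[n --> \oo] --> (0 : R).
Proof.
move=> s0; have span := null_argmax_span s_ge0 best mq (uniq mq) s0.
have jq j : (1 <= j < m.+1)%N -> (1 <= j <= q)%N.
  by move=> /andP[-> jm] /=; case/andP: mq => _; exact: leq_trans.
have : \sum_(1 <= j < m.+1) `|A n (phi j)| @[n --> \oo] --> (0 : R).
  by apply: cvg_nat_sum0 => j /jq /A_phi.
apply: squeeze0; apply: filterS2 h_norm S_phi => n hn Sp.
have Sp' j : (1 <= j < m.+1)%N -> S n (phi j) by move=> /jq; exact: Sp.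
rewrite normr_ge0 {1}(span (h n m)) big_nat.
have [_ ->] := linear_on_sum (S_lin n) (@A_lin n) (index_iota 1 m.+1)
  (fun j => inner (h n m) (phi j)) Sp'.
apply: le_trans (ler_norm_sum _ _ _) _; rewrite [leRHS]big_nat.
apply: ler_sum => j jm; rewrite normrZ ler_piMl //.
apply: le_trans (cauchy_schwarz _ _) _; rewrite phi_norm ?jq // mulr1.
exact: hn.
Qed.

Let h_norm_sqr : `|A n (h n m)| @[n --> \oo] --> (0 : R) ->
  `|h n m| ^+ 2 @[n --> \oo] --> (1 : R).
Proof.
move=> Ah; have : 1 - `|A n (h n m)| ^+ 2 @[n --> \oo] --> (1 : R).
  by apply: (cvgBr0 (u := fun=> 1)); [exact: cvg_cst|exact: cvg_sqr_0].
apply: cvg_trans; apply: near_eq_cvg; apply: filterS h_feas => n [[_ + _] _].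
by rewrite graph_inner_norm => <-; ring.
Qed.

Lemma direction_cvg_null : s (phi m) = 0 ->
  inner (h n m) (phi m) ^+ 2 @[n --> \oo] --> (1 : R).
Proof.
move=> s0; have span := null_argmax_span s_ge0 best mq (uniq mq) s0.
have -> : (fun n => inner (h n m) (phi m) ^+ 2) = (fun n => `|h n m| ^+ 2 - off n).
  apply/funext => n.
  suff -> : `|h n m| ^+ 2 = off n + inner (h n m) (phi m) ^+ 2.
    by rewrite addrAC subrr add0r.
  have sq l : inner (inner (h n m) (phi l) *: phi l) (h n m) =
      inner (h n m) (phi l) ^+ 2 by rewrite innerZl [inner (phi l) _]innerC.
  rewrite -inner_norm {1}(span (h n m)) inner_suml big_nat_recr /=; last first.
    by case/andP: mq.
  by rewrite sq; congr (_ + _); apply: eq_bigr => l _.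
apply: cvgBr0 => //; exact/h_norm_sqr/norm_penalty_vanishes_null.
Qed.

(** Once <h, phi m>^2 -> 1, the constraint |h|^2 + |A h|^2 = 1 leaves nothing for
the penalty. *)
Lemma step_recovered : recovered m.
Proof.
have dir : inner (h n m) (phi m) ^+ 2 @[n --> \oo] --> (1 : R).
  have := s_ge0 (phi m); rewrite le_eqVlt => /predU1P[/esym|].
    exact: direction_cvg_null.
  exact: direction_cvg_pos.
split=> //; first by apply: filterS h_feas => n [].
  apply: cvg_sqr0.
  have : 1 - inner (h n m) (phi m) ^+ 2 @[n --> \oo] --> (0 : R) by exact: cvg_gap0.
  apply: squeeze0; apply: filterS h_feas => n [[_ + _] _].
  rewrite graph_inner_norm sqr_ge0 /= => e.
  have := inner_sqr_le (h n m) (phi m); rewrite phi_norm // expr1n; lra.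
exact: objective_penalty_vanishes.
Qed.

End step.

Lemma all_recovered m : (1 <= m <= q)%N -> recovered m.
Proof.
elim/ltn_ind: m => m IH mq; apply: step_recovered => // l /andP[l1 lm].
apply: IH => //; rewrite l1; case/andP: mq => _; exact: leq_trans (ltnW lm).
Qed.

Lemma smoothed_directions_cvg m : (1 <= m <= q)%N ->
  [/\ recovered m, sn n (h n m) ^+ 2 @[n --> \oo] --> s (phi m) ^+ 2,
      s (h n m) ^+ 2 @[n --> \oo] --> s (phi m) ^+ 2 &
      `|h n m| @[n --> \oo] --> (1 : R)].
Proof.
move=> mq; have IH l : (1 <= l < m)%N -> recovered l.
  move=> /andP[l1 lm]; apply: all_recovered; rewrite l1.
  by case/andP: mq => _; exact: leq_trans (ltnW lm).
have rm := all_recovered mq; split=> //.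
- exact: empirical_scale_cvg.
- exact: population_scale_cvg.
have [hf _ _ hp] := rm; apply: aligned_norm (phi_norm mq) _ hp.
by apply: filterS hf => n /feasible_norm_le1[].
Qed.

End smoothed_directions.

Lemma cvg_EFin_near (R : realType) (T : Type) (F : set_system T)
    {FF : Filter F} (u : T -> R) (v : T -> \bar R) (l : R) :
  u x @[x --> F] --> l -> (\forall x \near F, v x = (u x)%:E) ->
  v x @[x --> F] --> l%:E.
Proof.
move=> ul vu; apply: cvg_EFin; first by apply: filterS vu => x ->.
apply: cvg_trans ul; apply: near_eq_cvg.
by apply: filterS vu => x /= ->.
Qed.

(** * The scale functional and the penalties *)

Section scale_of_projections.
Context {R : realType} {H : hilbertType R}.

Lemma dir_scaleZ (sR : probability R R -> R) (Q : probability (borel_space H) R)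
  (c : R) (a : H) : scale_functional sR ->
  dir_scale sR Q (c *: a) = `|c| * dir_scale sR Q a.
Proof.
move=> sRP; rewrite /dir_scale -(scale_affine sRP c 0); apply: (scale_ext sRP).
move=> B _; rewrite /marginal /distribution /= /pushforward; congr (Q _).
by apply/seteqP; split=> x /=; rewrite /projection /affine innerZl addr0.
Qed.

End scale_of_projections.

Section penalty.
Context {R : realType} {H : hilbertType R} (HS : set H) (D : H -> H).
Implicit Types (t r : R) (x y : H).

(** The vectors with finite penalties; if t = r = 0 this is every vector, by the
convention 0 * oo = 0. *)
Definition smooth_domain t r : set H := if (0 < t) || (0 < r) then HS else setT.

Definition scaled t x : H := Num.sqrt t *: D x.

Lemma smooth_domain_HS t r x : smooth_domain t r x ->
  (0 < t -> HS x) /\ (0 < r -> HS x).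
Proof. by rewrite /smooth_domain; case: (0 < t); case: (0 < r). Qed.

Lemma smooth_domain_linear t r :
  linear_subset HS -> linear_subset (smooth_domain t r).
Proof. by rewrite /smooth_domain; case: ifP. Qed.

Lemma scaled_linear (S : set H) t :
  (0 < t -> S `<=` HS) -> linear_on HS D -> linear_on S (scaled t).
Proof.
move=> tS DL c x y Sx Sy; rewrite /scaled; have [t0|t0] := ltP 0 t.
  by rewrite DL ?scalerDr ?scalerA 1?mulrC //; exact: tS.
by rewrite ler0_sqrtr // !scale0r scaler0 addr0.
Qed.

Lemma inner_scaled t x y : 0 <= t ->
  inner (scaled t x) (scaled t y) = t * pen_form D x y.
Proof. by move=> t0; rewrite innerZl innerZr mulrA -expr2 sqr_sqrtr. Qed.

Lemma scaled_norm t x : 0 <= t -> `|scaled t x| ^+ 2 = t * pen_form D x x.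
Proof. by move=> t0; rewrite -inner_norm inner_scaled. Qed.

Lemma Psi_scaled t x : 0 <= t -> (0 < t -> HS x) ->
  (t%:E * Psi HS D x = (`|scaled t x| ^+ 2)%:E)%E.
Proof.
rewrite le_eqVlt => /predU1P[<- _|t0 /(_ t0) xS].
  by rewrite mul0e /scaled sqrtr0 scale0r normr0 expr0n.
by rewrite /Psi mem_set // scaled_norm // ltW.
Qed.

Lemma norm_tau_eq1 t x : 0 <= t ->
  norm_tau HS D t x = 1%E <->
  (0 < t -> HS x) /\ `|x| ^+ 2 + `|scaled t x| ^+ 2 = 1.
Proof.
move=> t0; split=> [|[xS xe]]; last first.
  by rewrite /norm_tau Psi_scaled // -EFinD xe /= sqrtr1.
rewrite /norm_tau => nx.
have xS : 0 < t -> HS x.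
  move=> tp; move: nx; rewrite /Psi; case: ifPn => [/set_mem//|_].
  by rewrite gt0_muley.
split=> //; move: nx; rewrite Psi_scaled // -EFinD /=.
move=> -[/(congr1 (fun z => z ^+ 2))].
by rewrite sqr_sqrtr ?addr_ge0 ?sqr_ge0 // expr1n.
Qed.

(** The constrained maximisation with extended real penalties becomes one with
finite penalties on the smooth domain.  A maximiser lies in that domain because its
norm is finite and its objective is at least the finite one of the competitor y. *)
Lemma smooth_direction_graph (sR : probability R R -> R)
    (Q : nat -> probability (borel_space H) R) (t r : nat -> R)
    (h : nat -> nat -> H) n m y :
  0 <= t n -> 0 <= r n ->
  smooth_direction HS D sR (Q n) (t n) (r n) (h n) m (h n m) ->
  let S n := smooth_domain (t n) (r n) in
  let A n := scaled (t n) in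
  let sn n := dir_scale sR (Q n) in
  let C n := scaled (r n) in
  graph_feasible S A h n m y ->
  graph_feasible S A h n m (h n m) /\
  penalized sn C n y <= penalized sn C n (h n m).
Proof.
move=> t0 r0 [[h1 ho] hmax] S A sn C [Sy y1 yo].
have [yt yr] := smooth_domain_HS Sy.
have [ht he] := (norm_tau_eq1 _ t0).1 h1.
have graphE x z : graph_inner A n x z = inner_tau D (t n) x z.
  by rewrite /graph_inner /A inner_scaled.
have yfeas : smooth_feasible HS D (t n) (h n) m y.
  split; last by move=> j /yo; rewrite graphE.
  apply/norm_tau_eq1 => //; split=> //.
  by move: y1; rewrite graph_inner_norm.
have := hmax _ yfeas; rewrite Psi_scaled // -EFinB => le_y.
have hr : 0 < r n -> HS (h n m).
  move=> rp; move: le_y; rewrite /Psi; case: ifPn => [/set_mem//|_].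
  by rewrite gt0_muley.
move: le_y; rewrite Psi_scaled // -EFinB lee_fin => le_y.
split=> //; split; last by move=> j /ho; rewrite graphE.
  by rewrite /S /smooth_domain; case: ifP => [/orP[/ht|/hr]|].
by rewrite graph_inner_norm.
Qed.

End penalty.

(** * The theorem *)

Section pathwise.
Context {R : realType} {H : hilbertType R}.
Context (sR : probability R R -> R) (HS : set H) (D : H -> H)
  (P : probability (borel_space H) R)
  (Q : nat -> probability (borel_space H) R) (tau rho : nat -> R)
  (q : nat) (phi : nat -> H) (h : nat -> nat -> H).
Hypotheses (sRP : scale_functional sR)
  (HS_lin : linear_subset HS) (D_lin : linear_on HS D)
  (tau0 : forall n, 0 <= tau n) (rho0 : forall n, 0 <= rho n)
  (phiP : forall m, (1 <= m <= q)%N ->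
     principal_direction sR P phi m (phi m) /\
     forall a, principal_direction sR P phi m a -> a = phi m \/ a = - phi m)
  (hP : forall n m, (1 <= m <= q)%N ->
     smooth_direction HS D sR (Q n) (tau n) (rho n) (h n) m (h n m))
  (s_weak : continuous (dir_scale sR P : weak_space H -> R))
  (unif : ereal_sup [set (`|dir_scale sR (Q n) a ^+ 2 -
      dir_scale sR P a ^+ 2|)%:E | a in [set a : H | `|a| = 1]] @[n --> \oo]
    --> 0%E)
  (tau_cvg : tau n @[n --> \oo] --> (0 : R))
  (rho_cvg : rho n @[n --> \oo] --> (0 : R))
  (phi_smooth : exists n0 : nat, forall n, (n0 <= n)%N ->
     0 < tau n \/ 0 < rho n -> forall j, (1 <= j <= q)%N -> HS (phi j)).

Let scaled_cvg (t : nat -> R) x : t n @[n --> \oo] --> (0 : R) ->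
  `|scaled D (t n) x| @[n --> \oo] --> (0 : R).
Proof.
move=> t_cvg.
have st : Num.sqrt (t n) @[n --> \oo] --> (0 : R).
  by rewrite -sqrtr0; apply: cvg_comp t_cvg _; exact: sqrt_continuous.
have : `|D x| * Num.sqrt (t n) @[n --> \oo] --> (0 : R).
  by apply: cvgM0 st; exact: cvg_cst.
apply: cvg_trans; apply: near_eq_cvg; apply: nearW => n.
by rewrite /scaled normrZ mulrC ger0_norm ?sqrtr_ge0.
Qed.

Lemma pathwise_cvg m : (1 <= m <= q)%N ->
  [/\ [/\ dir_scale sR (Q n) (h n m) ^+ 2 @[n --> \oo] -->
            dir_scale sR P (phi m) ^+ 2,
          dir_scale sR P (h n m) ^+ 2 @[n --> \oo] -->
            dir_scale sR P (phi m) ^+ 2,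
          `|h n m| @[n --> \oo] --> (1 : R) &
          inner (h n m) (phi m) ^+ 2 @[n --> \oo] --> (1 : R)],
      ((rho n)%:E * Psi HS D (h n m))%E @[n --> \oo] --> 0%E,
      ((tau n)%:E * Psi HS D (h n m))%E @[n --> \oo] --> 0%E &
      tau n * pen_form D (h n m) (h n m) @[n --> \oo] --> (0 : R)].
Proof.
move=> mq.
pose S n := smooth_domain HS (tau n) (rho n).
pose A n := scaled D (tau n).
pose C n := scaled D (rho n).
pose sn n := dir_scale sR (Q n).
have S_lin n : linear_subset (S n) by exact: smooth_domain_linear.
have A_lin n : linear_on (S n) (A n).
  by apply: scaled_linear D_lin => t0 x Sx; exact: (smooth_domain_HS Sx).1.
have C_lin n : linear_on (S n) (C n).
  by apply: scaled_linear D_lin => t0 x Sx; exact: (smooth_domain_HS Sx).2.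
have S_phi : \forall n \near \oo, forall j, (1 <= j <= q)%N -> S n (phi j).
  have [n0 Hn0] := phi_smooth; exists n0 => // n /= n0n j jq.
  by rewrite /S /smooth_domain; case: ifP => [/orP c|//]; exact: (Hn0 n).
have sn_unif (e : R) : 0 < e -> \forall n \near \oo, forall a : H,
    `|a| = 1 -> `|sn n a ^+ 2 - dir_scale sR P a ^+ 2| <= e.
  move=> e0; have /fine_cvgP[X_fin /(@cvgr0Pnorm_le _ R^o) /(_ e e0)] := unif.
  apply: filterS2 X_fin => n X_fin X_le a a1.
  rewrite -lee_fin; apply: (@le_trans _ _ (ereal_sup [set (`|sn n a ^+ 2 -
    dir_scale sR P a ^+ 2|)%:E | a in [set a : H | `|a| = 1]])).
    by apply: ereal_sup_ubound; exists a.
  by rewrite -(fineK X_fin) lee_fin (le_trans (ler_norm _)).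
have [[h_feas Ah Ch dir] snh sh nh] := smoothed_directions_cvg
  (fun x => scale_ge0 sRP _) (fun c x => dir_scaleZ P c x sRP) s_weak
  (fun m mq => (phiP mq).1) (fun m mq => (phiP mq).2)
  (fun n c x => dir_scaleZ (Q n) c x sRP) sn_unif S_lin A_lin C_lin S_phi
  (fun j _ => scaled_cvg (phi j) tau_cvg) (fun j _ => scaled_cvg (phi j) rho_cvg)
  (fun n m y mq => smooth_direction_graph (tau0 n) (rho0 n) (hP n mq)) mq.
split=> //.
- apply: cvg_EFin_near (cvg_sqr_0 Ch) _.
  apply: filterS h_feas => n [Sh _ _].
  by apply: Psi_scaled => //; exact: (smooth_domain_HS Sh).2.
- apply: cvg_EFin_near (cvg_sqr_0 Ah) _.
  apply: filterS h_feas => n [Sh _ _].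
  by apply: Psi_scaled => //; exact: (smooth_domain_HS Sh).1.
- apply: cvg_trans (cvg_sqr_0 Ah); apply: near_eq_cvg; apply: nearW => n.
  by rewrite scaled_norm.
Qed.

End pathwise.

Theorem theorem4p1 (R : realType) (H : hilbertType R)
  (d : measure_display) (Omega : measurableType d) (Pr : probability Omega R)
  (sR : probability R R -> R)
  (HS : set H) (D : H -> H)
  (P : probability (borel_space H) R)
  (Pn : nat -> {mfun Omega >-> pprobability (borel_space H) R})
  (tau rho : nat -> {RV Pr >-> R})
  (q : nat) (phi : nat -> H) (hphi : nat -> Omega -> nat -> H) :
  separable_space H ->
  scale_functional sR ->
  linear_subset HS -> linear_on HS D -> closable HS D ->
  (forall n w, 0 <= tau n w) -> (forall n w, 0 <= rho n w) ->
  (2 <= q)%N ->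
  (forall m, (1 <= m <= q)%N ->
     principal_direction sR P phi m (phi m) /\
     forall a, principal_direction sR P phi m a -> a = phi m \/ a = - phi m) ->
  (forall n w m, (1 <= m <= q)%N ->
     smooth_direction HS D sR (Pn n w) (tau n w) (rho n w) (hphi n w) m
       (hphi n w m)) ->
  (* (i) *)
  continuous (dir_scale sR P : weak_space H -> R) ->
  (* (ii) *)
  cvg_as Pr (fun n w =>
    ereal_sup [set (`|dir_scale sR (Pn n w) a ^+ 2 - dir_scale sR P a ^+ 2|)%:E
                | a in [set a : H | `|a| = 1]]) 0%E ->
  (* (iii) *)
  cvg_as Pr (fun n w => tau n w) 0 -> cvg_as Pr (fun n w => rho n w) 0 ->
  (* (iv) *)
  {ae Pr, forall w, exists n0 : nat, forall n, (n0 <= n)%N ->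
     0 < tau n w \/ 0 < rho n w -> forall j, (1 <= j <= q)%N -> HS (phi j)} ->
  (* (a) *)
  [/\ cvg_as Pr (fun n w => dir_scale sR (Pn n w) (hphi n w 1%N) ^+ 2)
        (principal_value sR P phi 1),
      cvg_as Pr (fun n w => dir_scale sR P (hphi n w 1%N) ^+ 2) (dir_scale sR P (phi 1%N) ^+ 2),
      cvg_as Pr (fun n w => (rho n w)%:E * Psi HS D (hphi n w 1%N))%E 0%E,
      cvg_as Pr (fun n w =>
        tau n w * pen_form D (hphi n w 1%N) (hphi n w 1%N)) 0 &
      cvg_as Pr (fun n w => `|hphi n w 1%N|) 1] /\
  (* (b) *)
  cvg_as Pr (fun n w => inner (hphi n w 1%N) (phi 1%N) ^+ 2) 1 /\
  (* (c) *)
  (forall m, (2 <= m <= q)%N ->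
     (forall l, (1 <= l < m)%N ->
        [/\ cvg_as Pr (fun n w => hphi n w l) (phi l),
            cvg_as Pr (fun n w => (tau n w)%:E * Psi HS D (hphi n w l))%E 0%E &
            cvg_as Pr (fun n w => (rho n w)%:E * Psi HS D (hphi n w l))%E
              0%E]) ->
     [/\ cvg_as Pr (fun n w => dir_scale sR (Pn n w) (hphi n w m) ^+ 2)
           (dir_scale sR P (phi m) ^+ 2),
         cvg_as Pr (fun n w => dir_scale sR P (hphi n w m) ^+ 2) (dir_scale sR P (phi m) ^+ 2),
         cvg_as Pr (fun n w => (rho n w)%:E * Psi HS D (hphi n w m))%E 0%E,
         cvg_as Pr (fun n w => (tau n w)%:E * Psi HS D (hphi n w m))%E 0%E &
         cvg_as Pr (fun n w => `|hphi n w m|) 1]) /\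
  (* (d) *)
  (forall m, (1 <= m <= q)%N ->
     cvg_as Pr (fun n w => inner (hphi n w m) (phi m) ^+ 2) 1).
Proof.
move=> _ sRP HS_lin D_lin _ tau0 rho0 q2 phiP hP s_weak unif tau_cvg rho_cvg iv.
have FF : Filter (almost_everywhere Pr) by exact: ae_filter_ringOfSetsType.
have main : {ae Pr, forall w, forall m, (1 <= m <= q)%N ->
  [/\ [/\ dir_scale sR (Pn n w) (hphi n w m) ^+ 2 @[n --> \oo] -->
            dir_scale sR P (phi m) ^+ 2,
          dir_scale sR P (hphi n w m) ^+ 2 @[n --> \oo] -->
            dir_scale sR P (phi m) ^+ 2,
          `|hphi n w m| @[n --> \oo] --> (1 : R) &
          inner (hphi n w m) (phi m) ^+ 2 @[n --> \oo] --> (1 : R)],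
      ((rho n w)%:E * Psi HS D (hphi n w m))%E @[n --> \oo] --> 0%E,
      ((tau n w)%:E * Psi HS D (hphi n w m))%E @[n --> \oo] --> 0%E &
      tau n w * pen_form D (hphi n w m) (hphi n w m) @[n --> \oo]
        --> (0 : R)]}.
  apply: (@filterS3 _ _ FF _ _ _ _ _ unif
    (@filterI _ _ FF _ _ tau_cvg rho_cvg) iv) => w unif_w [tau_w rho_w] iv_w m mq.
  exact: (pathwise_cvg sRP HS_lin D_lin (fun n => tau0 n w)
    (fun n => rho0 n w) phiP (fun n m mq => hP n w m mq) s_weak unif_w
    tau_w rho_w iv_w mq).
have q1 : (1 <= 1 <= q)%N by rewrite /= ltnW.
split; last split.
- by split; apply: (@filterS _ _ FF _ _ _ main) => w /(_ _ q1) [[]].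
- by apply: (@filterS _ _ FF _ _ _ main) => w /(_ _ q1) [[]].
split=> m mq; last by apply: (@filterS _ _ FF _ _ _ main) => w /(_ _ mq) [[]].
have mq' : (1 <= m <= q)%N by case/andP: mq => /ltnW ->.
by move=> _; split; apply: (@filterS _ _ FF _ _ _ main) => w /(_ _ mq') [[]].
Qed.
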